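(* There exist finite simple $3$-connected cubic graphs $G$ and $H$ on $12$ vertices with $\Gamma_G=\Gamma_H$ but distinct adjacency spectra. Moreover, there exist finite simple connected cubic graphs with equal adjacency spectra but distinct orientable genus polynomials; hence, for connected cubic graphs, the orientable genus polynomial and the adjacency spectrum are incomparable, i.e. neither determines the other.
   Context: Cubic means $3$-regular. A graph is $3$-connected if it is connected, has at least four vertices, and has no vertex cut of size at most $2$. Genus polynomial. A dart of $G$ is an ordered pair $(u,v)$ with $uv\in E(G)$. A rotation system $\rho$ of $G$ assigns to each vertex $v$ a cyclic ordering of its neighbours; $\sigma_v(u)$ denotes the neighbour of $v$ following $u$. The face permutation of $\rho$ on darts is $\phi_\rho(u,v)=(v,\sigma_v(u))$; its cycles are the faces of $\rho$, and $F(\rho)$ is their number. For a connected cubic graph on $n$ vertices there are $2^n$ rotation systems, and the genus of $\rho$ is given by Euler's formula, $g(\rho)=1+\frac n4-\frac12F(\rho)$. The orientable genus polynomial is $\Gamma_G(x)=\sum_\rho x^{g(\rho)}$, the sum over all rotation systems of $G$. *)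

(* Defs.v *)
From HB Require Import structures.
From mathcomp Require Import all_boot all_order all_algebra all_fingroup all_field.
From mathcomp Require Import finmap multiset.

Set Implicit Arguments.
Unset Strict Implicit.
Unset Printing Implicit Defensive.

Import Order.TTheory GRing.Theory Num.Theory.

Local Open Scope ring_scope.

(* A finite simple graph; [#|G|] is its number of vertices. *)
Record sgraph := SGraph {
  vertex :> finType;
  adj : rel vertex;
  adj_sym : symmetric adj;
  adj_irrefl : irreflexive adj }.

Section Graph.
Variable G : sgraph.

Definition nbrs (v : G) : {set G} := [set u | adj v u].

Definition cubic : Prop := forall v : G, #|nbrs v| = 3%N.

Definition connected_graph : Prop :=
  (0 < #|G|)%N /\ forall x y : G, connect (@adj G) x y.

Definition adj_minus (S : {set G}) : rel G :=
  [rel x y | [&& x \notin S, y \notin S & adj x y]].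

Definition vertex_cut (S : {set G}) : Prop :=
  exists x y : G,
    [/\ x \notin S, y \notin S & ~~ connect (adj_minus S) x y].

Definition three_connected : Prop :=
  [/\ connected_graph, (4 <= #|G|)%N
    & forall S : {set G}, vertex_cut S -> ~ (#|S| <= 2)%N].

(* A cyclic ordering of the neighbours of [v] is encoded by its successor map
   [rho v], extended by the identity outside [nbrs v]: a permutation supported
   on [nbrs v] and having [nbrs v] as a single cycle. *)
Definition is_rotation (rho : {ffun G -> {perm G}}) : bool :=
  [forall v : G, perm_on (nbrs v) (rho v) &&
     [forall u in nbrs v, porbit (rho v) u == nbrs v]].

Definition rotations : {set {ffun G -> {perm G}}} := [set rho | is_rotation rho].

Definition darts : {set G * G} := [set d : G * G | adj d.1 d.2].

Definition face_map (rho : {ffun G -> {perm G}}) (d : G * G) : G * G :=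
  (d.2, rho d.2 d.1).

Lemma face_map_inj rho : injective (face_map rho).
Proof. by move=> [u v] [u' v'] [/= <-] /perm_inj ->. Qed.

(* The face permutation is extended to all pairs of vertices; for a rotation
   system it preserves the set of darts (see [face_perm_dart]), and only its
   cycles on darts are counted as faces. *)
Definition face_perm (rho : {ffun G -> {perm G}}) : {perm G * G} :=
  perm (@face_map_inj rho).

Lemma face_perm_dart rho d :
  rho \in rotations -> d \in darts -> face_perm rho d \in darts.
Proof.
case: d => u v; rewrite !inE permE /= => /forallP/(_ v)/andP[Sv _] uv.
by move: (perm_closed u Sv); rewrite !inE [adj v u]adj_sym uv.
Qed.

Definition faces (rho : {ffun G -> {perm G}}) : {set {set G * G}} :=
  [set porbit (face_perm rho) d | d in darts].

(* Euler's formula for a connected cubic graph: #|G| vertices and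
   3 * #|G| / 2 edges. *)
Definition genus (rho : {ffun G -> {perm G}}) : rat :=
  1 + #|G|%:R / 4%:R - #|faces rho|%:R / 2%:R.

(* [Num.truncn] only casts the genus to [nat]: for a rotation system of a
   connected cubic graph, [genus rho] is a nonnegative integer. *)
Definition genus_poly : {poly int} :=
  \sum_(rho in rotations) 'X^(Num.truncn (genus rho)).

Definition adj_mx : 'M[algC]_#|G| :=
  \matrix_(i, j) (adj (enum_val i) (enum_val j))%:R.

(* The multiset of eigenvalues, with algebraic multiplicities. *)
Definition spectrum : {mset algC}%mset :=
  seq_mset (sval (closed_field_poly_normal (char_poly adj_mx))).

Lemma spectrum_char_poly :
  char_poly adj_mx = \prod_(a <- spectrum) ('X - a%:P).
Proof.
rewrite /spectrum (perm_big _ (perm_eq_seq_mset _)) /=.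
by case: closed_field_poly_normal => s /= {1}->;
   rewrite (monicP (char_poly_monic _)) scale1r.
Qed.

Lemma mem_spectrum a : (a \in spectrum) = eigenvalue adj_mx a.
Proof.
rewrite eigenvalue_root_char spectrum_char_poly root_prod_XsubC.
by rewrite -(perm_mem (perm_eq_seq_mset _)) seq_mset_id.
Qed.

End Graph.

(* Within the class [P] of graphs, the invariant [I] determines [J]. *)
Definition determines (P : sgraph -> Prop) (A B : Type)
    (I : sgraph -> A) (J : sgraph -> B) : Prop :=
  forall G H : sgraph, P G -> P H -> I G = I H -> J G = J H.

Definition connected_cubic (G : sgraph) : Prop := connected_graph G /\ cubic G.

(* Main.v *)
Require Import Defs.
From mathcomp Require Import all_boot all_order all_algebra all_fingroup all_field.
From mathcomp Require Import finmap multiset.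
From mathcomp Require Import lra.

(** Four explicit graphs witness the theorem.

    [nonsingular_graph] and [singular_graph] are 3-connected cubic planar graphs
    on 12 vertices with common genus polynomial 2 + 134 x + 1592 x^2 + 2368 x^3.
    The first has an invertible adjacency matrix ([unit_nonsingular]).  The
    second has the eigenvalue 0: every vertex has exactly one neighbour congruent
    to 1 modulo 3, so weighting these vertices by -2 and all others by 1 makes
    the weights of the neighbours of each vertex sum to 0 ([not_unit_singular]).

    [unswitched_graph] and [switched_graph] are cubic graphs on 14 vertices that
    differ by Godsil-McKay switching: the set C = {3, 5, 6, 7} is independent,
    every other vertex has 0 or 2 neighbours in C, and the vertices with 2
    neighbours in C are joined to the other two vertices of C instead.  Conjugation
    by the involution that is J/2 - I on C and the identity elsewhere exchanges
    the adjacency matrices ([spectrum_switching]).  The graphs have 88 and 64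
    rotation systems of genus 1, respectively.

    The genus polynomials are found by a transfer-matrix computation instead of
    an enumeration of all 2^n rotation systems.  A vertex of a cubic graph has
    exactly two rotations, a 3-cycle and its inverse, so a rotation system is a
    bit per vertex ([rotationsE]).  The faces are the cycles of a permutation of
    the darts, and removing a dart x from the cycle that contains it (its
    predecessor is sent to the successor of x) changes the number of cycles only
    when x is a fixed point ([ncycles_porbits_on]).  Fixing the rotation at a
    vertex v determines the successors of the three darts into v, which can then
    be removed; what remains is a smaller instance of the same counting problem,
    in which only the targets of darts near the processed part of the graph have
    changed.  Many partial choices lead to the same remaining problem, and
    [cycle_table] counts them together; [sum_turns] is the correctness of this
    computation.  *)

Set Implicit Arguments.
Unset Strict Implicit.
Unset Printing Implicit Defensive.

Import Order.TTheory GRing.Theory Num.Theory.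

(** * Counting the cycles of a permutation by contraction *)

Section Contraction.
Variable T : eqType.
Implicit Types (l : T * T) (L s : seq (T * T)) (f g : T -> T) (k : nat).

(** A list of pairs (x, y) stands for a map sending each x to its y. *)
Definition retarget f L := [seq (l.1, f l.2) | l <- L].

(** Removes the source of [l] from a map.  The accumulator holds the number of
    cycles closed so far and the renaming of targets caused by the previous
    removals: whatever pointed to a removed point points to its successor. *)
Definition contract (a : nat * (T -> T)) l :=
  let y := a.2 l.2 in
  (a.1 + (l.1 == y), fun z => let w := a.2 z in if w == l.1 then y else w).

Definition ncycles L := (foldl contract (0, id) L).1.

Lemma contract_retarget k f g L :
  (foldl contract (k, g) (retarget f L)).1 = (foldl contract (k, g \o f) L).1.
Proof. by elim: L k g => //= l L IH k g; exact: IH. Qed.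

Lemma contract_shift k f L :
  (foldl contract (k, f) L).1 = k + (foldl contract (0, f) L).1.
Proof.
elim: L k f => [|l L IH] k f /=; first by rewrite addn0.
by rewrite IH [in RHS]IH add0n addnA.
Qed.

Lemma ncycles_cons l L :
  ncycles (l :: L) =
  (l.1 == l.2) + ncycles (retarget (fun z => if z == l.1 then l.2 else z) L).
Proof.
rewrite /ncycles contract_retarget.
exact: (contract_shift (l.1 == l.2) _ L).
Qed.

Lemma ncycles_cat L L' :
  ncycles (L ++ L') =
  (foldl contract (0, id) L).1
  + ncycles (retarget (foldl contract (0, id) L).2 L').
Proof.
rewrite {1}/ncycles foldl_cat /ncycles contract_retarget.
by case: (foldl _ _ L) => k f; rewrite contract_shift.
Qed.

End Contraction.

Section CyclesOfPermutations.
Local Open Scope group_scope.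
Variable T : finType.
Implicit Types (p : {perm T}) (s : seq T).

Lemma porbit_fixed p x : p x = x -> porbit p x = [set x].
Proof.
move=> px; apply/setP=> y; rewrite inE; apply/porbitP/eqP => [[i ->]|->].
  by elim: i => [|i IH]; rewrite ?expgSr ?permM ?IH ?perm1.
by exists 0%N; rewrite perm1.
Qed.

(** Each point outside [s] is fixed and is a cycle that the list does not
    count.  Removing x from the cycles of p amounts to composing p with the
    transposition of x and p^-1 x, which splits off x as a fixed point. *)
Lemma ncycles_porbits_on p s :
  uniq s -> {in predC (mem s), p =1 id} ->
  (ncycles [seq (x, p x) | x <- s] + #|T| = #|porbits p| + size s)%N.
Proof.
elim: s p => [|x s IH] p /= => [_ pid|/andP[xs us] pid].
  have ->: p = 1 by apply/permP=> x; rewrite perm1; apply: pid.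
  rewrite /ncycles /= addn0 add0n /porbits.
  rewrite (eq_imset _ (fun x => porbit_fixed (perm1 x))).
  by rewrite card_imset //; apply: set1_inj.
pose q := tperm x (p^-1 x) * p.
have qE y : q y = if y == x then x else if p y == x then p x else p y.
  rewrite permM; case: tpermP => [->|->|/eqP/negPf-> /eqP/negPf ypx].
  - by rewrite eqxx permKV.
  - by rewrite permKV eqxx; case: eqP => // e; rewrite -{1}e permKV.
  by rewrite -[p y == x](inj_eq (@perm_inj _ p^-1)) permK ypx.
have qid : {in predC (mem s), q =1 id}.
  move=> y; rewrite inE /= => ys; rewrite qE; case: eqP => [-> //|/eqP yx].
  by rewrite pid ?(negPf yx) // !inE negb_or yx ys.
have := IH q us qid; have := porbits_mul_tperm p x (p^-1 x); rewrite /= -/q.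
have -> : x \in porbit p (p^-1 x).
  by have := mem_porbit p 1 (p^-1 x); rewrite expg1 permKV.
rewrite addn0 => ->; rewrite ncycles_cons /= /retarget -map_comp.
have -> : (x != p^-1 x) = (x != p x).
  by rewrite -(inj_eq (@perm_inj _ p) x) permKV eq_sym.
set L := map _ s; set L' := map _ s; have -> : L = L'.
  apply/eq_in_map => y ys /=; rewrite qE; case: (y =P x) => // yx.
  by rewrite yx (negPf xs) in ys.
case: eqP => _ /=; rewrite ?addn0 ?addn1 => e;
  by rewrite ?add0n ?addnS -?e ?add1n // addSn e.
Qed.

(** Restricting p to [s] makes every other point an orbit of its own, which
    reduces this to the count of all orbits. *)
Lemma ncycles_porbits p s :
  uniq s -> {in s, forall x, p x \in s} ->
  ncycles [seq (x, p x) | x <- s] = #|[set porbit p x | x in s]|.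
Proof.
move=> us ps; pose S := [set x in s].
have pN : p \in 'N(S | 'P).
  by rewrite !inE; apply/subsetP=> x; rewrite !inE; apply: ps.
pose q := restr_perm S p.
have qp x : x \in s -> q x = p x by move=> xs; rewrite /q restr_permE // inE.
have qid : {in predC (mem s), q =1 id}.
  move=> x; rewrite inE /= => xs.
  by apply: (out_perm (restr_perm_on S p)); rewrite inE.
have := ncycles_porbits_on us qid.
have -> : [seq (x, q x) | x <- s] = [seq (x, p x) | x <- s].
  by apply/eq_in_map => x /qp ->.
have qporb x : x \in s -> porbit q x = porbit p x.
  move=> xs; apply/setP=> y.
  have qpi i : (q ^+ i) x = (p ^+ i) x /\ (p ^+ i) x \in s.
    elim: i => [|i [IH IHs]]; first by rewrite !expg0 !perm1.
    by rewrite !expgSr !permM IH qp //; split=> //; apply: ps.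
  by apply/porbitP/porbitP => -[i ->]; exists i; have [] := qpi i.
have -> : porbits q = [set porbit p x | x in s] :|: [set [set x] | x in ~: S].
  apply/setP=> A; apply/imsetP/setUP => [[x _ ->]|].
    have [xs|xs] := boolP (x \in s); [left|right].
      by rewrite qporb //; apply: imset_f.
    apply/imsetP; exists x; first by rewrite !inE.
    by rewrite porbit_fixed ?qid.
  case=> /imsetP[x xs ->]; exists x => //; first by rewrite qporb.
  by rewrite porbit_fixed // qid //; rewrite !inE in xs *.
have dis : [disjoint [set porbit p x | x in s] & [set [set x] | x in ~: S]].
  apply/pred0P=> A /=; apply/negP => /andP[/imsetP[x xs ->] /imsetP[y]].
  rewrite !inE => ys e; have : x \in [set y] by rewrite -e porbit_id.
  by rewrite inE => /eqP xy; rewrite -xy xs in ys.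
rewrite cardsU (disjoint_setI0 dis) cards0 subn0 (card_imset _ (@set1_inj T)).
have -> : size s = #|S| by rewrite cardsE; apply/esym/card_uniqP.
by rewrite -addnA [(#|~: S| + _)%N]addnC cardsC => /addIn.
Qed.

End CyclesOfPermutations.

(** * The table of remaining problems *)

Section Transfer.
Variable T : eqType.
Implicit Types (L s : seq (T * T)) (t : bitseq).

(** The list [s] holds three consecutive pairs for each vertex v: a dart into v,
    and the current name of the dart that leaves v along the same edge.  The bit
    [b] selects the cyclic order of the three edges at the first vertex. *)
Definition turn (b : bool) s :=
  if s is [:: p, q, r & _] then
    if b then [:: (p.1, r.2); (q.1, p.2); (r.1, q.2)]
    else [:: (p.1, q.2); (q.1, r.2); (r.1, p.2)]
  else [::].

Fixpoint turns t s :=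
  if t is b :: t' then turn b s ++ turns t' (drop 3 s) else [::].

Lemma retarget_turns f t s : retarget f (turns t s) = turns t (retarget f s).
Proof.
elim: t s => //= b t IH s; rewrite /retarget map_cat -map_drop -IH.
by congr (_ ++ _); case: s => [|p [|q [|r s]]] //; case: b.
Qed.

(** Fixes the rotation at the first vertex and removes its three incoming darts;
    the pair carries the number of faces completed so far. *)
Definition resolve b (a : nat * seq (T * T)) : nat * seq (T * T) :=
  let c := foldl (@contract T) (0, id) (turn b a.2) in
  (a.1 + c.1, retarget c.2 (drop 3 a.2)).

Lemma ncycles_turns_cons b t k s :
  (k + ncycles (turns (b :: t) s) =
   (resolve b (k, s)).1 + ncycles (turns t (resolve b (k, s)).2))%N.
Proof. by rewrite ncycles_cat retarget_turns addnA. Qed.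

(** An entry is (multiplicity, (completed faces, remaining ports)). *)
Definition table := seq (nat * (nat * seq (T * T))).

Fixpoint tally (c : nat) a (tb : table) : table :=
  if tb is e :: tb' then
    if a == e.2 then (c + e.1, a) :: tb' else e :: tally c a tb'
  else [:: (c, a)].

Definition advance (tb : table) : table :=
  foldr (fun e tb' =>
    tally e.1 (resolve false e.2) (tally e.1 (resolve true e.2) tb')) [::] tb.

Definition cycle_table m s : table := iter m advance [:: (1, (0, s))].

Fixpoint bitseqs m : seq bitseq :=
  if m is m'.+1 then
    map (cons false) (bitseqs m') ++ map (cons true) (bitseqs m')
  else [:: [::]].

Section Sum.
Variables (V : nmodType) (F : nat -> V).

Local Open Scope ring_scope.

Definition turns_sum m (a : nat * seq (T * T)) : V :=
  \sum_(t <- bitseqs m) F (a.1 + ncycles (turns t a.2)).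

Definition table_sum m (tb : table) : V :=
  \sum_(e <- tb) turns_sum m e.2 *+ e.1.

(** The two summands are the two rotations at the first vertex. *)
Lemma turns_sumS m a :
  turns_sum m.+1 a =
  turns_sum m (resolve false a) + turns_sum m (resolve true a).
Proof.
case: a => k s; rewrite /turns_sum big_cat /= !big_map.
by congr (_ + _); apply: eq_bigr => t _; rewrite -ncycles_turns_cons.
Qed.

Lemma table_sum_tally m c a tb :
  table_sum m (tally c a tb) = turns_sum m a *+ c + table_sum m tb.
Proof.
rewrite /table_sum; elim: tb => [|e tb IH] /=.
  by rewrite !big_seq1 big_nil addr0.
case: eqP => [->|_]; rewrite !big_cons /=; last by rewrite IH addrCA.
by rewrite mulrnDr addrA.
Qed.

Lemma table_sum_advance m tb : table_sum m (advance tb) = table_sum m.+1 tb.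
Proof.
elim: tb => [|e tb IH]; first by rewrite /table_sum !big_nil.
by rewrite /= !table_sum_tally IH /table_sum big_cons turns_sumS mulrnDl addrA.
Qed.

(** Each [advance] preserves the sum over all completions; after all [m] steps, only the
    numbers of completed faces remain. *)
Lemma sum_turns m s :
  \sum_(t <- bitseqs m) F (ncycles (turns t s)) =
  \sum_(e <- cycle_table m s) F e.2.1 *+ e.1.
Proof.
transitivity (table_sum m [:: (1%N, (0%N, s))]).
  by rewrite /table_sum big_seq1 mulr1n.
rewrite /cycle_table; move: [:: _] => tb; elim: m tb => [|m IH] tb.
  apply: eq_bigr => e _; congr (_ *+ _).
  by rewrite /turns_sum big_seq1 /ncycles /= addn0.
by rewrite -table_sum_advance IH iterSr.
Qed.

End Sum.
End Transfer.

Lemma mem_bitseqs m t : (t \in bitseqs m) = (size t == m).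
Proof.
elim: m t => [|m IH] [|b t] //=.
  by rewrite mem_cat; apply/norP; split; apply/mapP => -[].
have consE c :
    (b :: t \in map (cons c) (bitseqs m)) = (b == c) && (size t == m).
  by rewrite -IH; apply/mapP/andP => [[u us [-> ->]]|[/eqP-> ts]]; [|exists t].
by rewrite mem_cat !consE eqSS; case: (b); rewrite ?orbF.
Qed.

Lemma uniq_bitseqs m : uniq (bitseqs m).
Proof.
elim: m => //= m IH; have c (b : bool) : injective (cons b) by move=> ? ? [].
rewrite cat_uniq !(map_inj_uniq (c _)) IH andbT /=.
by apply/hasP => -[_ /mapP[t _ ->] /mapP[]].
Qed.

Section Rename.
Variables (T T' : eqType) (h : T -> T').
Hypothesis h_inj : injective h.

Definition rename (L : seq (T * T)) := [seq (h l.1, h l.2) | l <- L].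

Lemma ncycles_rename L : ncycles (rename L) = ncycles L.
Proof.
suff gen k f f' : f' \o h =1 h \o f ->
    (foldl (@contract T') (k, f') (rename L)).1 =
    (foldl (@contract T) (k, f) L).1.
  exact: gen.
elim: L k f f' => //= l L IH k f f' hf; rewrite /contract /=.
have e z : f' (h z) = h (f z) by apply: hf.
rewrite !e (inj_eq h_inj); apply: IH => z /=.
by rewrite !e (inj_eq h_inj); case: ifP.
Qed.

Lemma turns_rename t s : turns t (rename s) = rename (turns t s).
Proof.
elim: t s => //= b t IH s; rewrite /rename map_cat -map_drop.
congr (_ ++ _); last exact: IH.
by case: s => [|p [|q [|r s]]] //; case: b.
Qed.

End Rename.

(** Rotation systems are indexed by functions, the table by bit sequences. *)
Lemma sum_bitseqs (T : finType) (V : nmodType) (F : bitseq -> V) :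
  (\sum_(f : {ffun T -> bool}) F [seq f x | x <- enum T] =
   \sum_(t <- bitseqs #|T|) F t)%R.
Proof.
pose h (f : {ffun T -> bool}) := [seq f x | x <- enum T].
have h_inj : injective h.
  by move=> f g /eq_in_map e; apply/ffunP=> x; apply: e; rewrite mem_enum.
rewrite -(big_map h xpredT F); apply/perm_big/uniq_perm.
- by rewrite map_inj_uniq ?index_enum_uniq.
- exact: uniq_bitseqs.
move=> t; rewrite mem_bitseqs; apply/mapP/eqP => [[f _ ->]|ts].
  by rewrite size_map -cardE.
exists [ffun x => nth false t (index x (enum T))]; first by rewrite mem_index_enum.
apply: (@eq_from_nth _ false) => [|i]; first by rewrite size_map -cardE.
rewrite ts => iT.
have i_lt : (i < size (enum T))%N by rewrite -cardE.
have [x0 _] : exists x0 : T, true.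
  by move: i_lt; case: (enum T) => // x0 *; exists x0.
by rewrite (nth_map x0) // ffunE index_uniq ?enum_uniq.
Qed.

(** * Rotation systems of cubic graphs *)

Section ThreeCycle.
Local Open Scope group_scope.
Variable T : finType.
Implicit Types (a b c : T) (p : {perm T}).

Definition cycle3 a b c : {perm T} := tperm a b * tperm a c.

Lemma uniq_swap a b c : uniq [:: a; c; b] = uniq [:: a; b; c].
Proof. by apply: perm_uniq; rewrite perm_cons (perm_catC [:: c] [:: b]). Qed.

Lemma cycle3E a b c : uniq [:: a; b; c] ->
  [/\ cycle3 a b c a = b, cycle3 a b c b = c & cycle3 a b c c = a].
Proof.
rewrite /= !inE negb_or andbT => /andP[/andP[ab ac] bc].
have [ba cb] : b != a /\ c != b by rewrite eq_sym ab eq_sym bc.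
rewrite !permM tpermL tpermR tpermL (@tpermD _ a c b) //.
by rewrite (@tpermD _ a b c) // ?tpermR // eq_sym.
Qed.

Lemma cycle3_rotation a b c : uniq [:: a; b; c] ->
  let S := [set x in [:: a; b; c]] in
  perm_on S (cycle3 a b c) /\ {in S, forall x, porbit (cycle3 a b c) x = S}.
Proof.
move=> u S; have [pa pb pc] := cycle3E u; set p := cycle3 a b c in pa pb pc *.
have pS : perm_on S p.
  apply/subsetP=> x; rewrite !inE; apply: contraNT; rewrite !negb_or.
  by case/and3P=> xa xb xc; rewrite permM !tpermD // 1?eq_sym.
have oa : porbit p a = S.
  apply/eqP; rewrite eqEsubset; apply/andP; split; apply/subsetP=> x.
    case/porbitP=> i ->; elim: i => [|i IH]; first by rewrite perm1 !inE eqxx.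
    by rewrite expgSr permM perm_closed.
  rewrite !inE => /or3P[]/eqP->; first exact: porbit_id.
    by rewrite -pa -[p a]/((p ^+ 1) a) mem_porbit.
  by rewrite -pb -pa -permM -[p * p]/(p ^+ 2) mem_porbit.
split=> // x xS; rewrite -oa; apply/eqP.
by rewrite eq_porbit_mem oa.
Qed.

Lemma porbit_sub p x (X : {set T}) :
  x \in X -> {in X, forall y, p y \in X} -> porbit p x \subset X.
Proof.
move=> xX pX; apply/subsetP=> y /porbitP[i ->].
by elim: i => [|i IH]; rewrite ?perm1 // expgSr permM pX.
Qed.

(** Were p b equal to a or b, the orbit of a would miss c. *)
Lemma rotation_cycle3_of p a b c : uniq [:: a; b; c] ->
  let S := [set x in [:: a; b; c]] in
  perm_on S p -> {in S, forall x, porbit p x = S} ->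
  p a = b -> p = cycle3 a b c.
Proof.
move=> u S pS orb pa; have [qa qb qc] := cycle3E u.
have [qS _] := cycle3_rotation u; rewrite -/S in qS.
move: (u); rewrite /= !inE negb_or andbT => /andP[/andP[ab ac] bc].
have [aS bS cS] : [/\ a \in S, b \in S & c \in S] by rewrite !inE !eqxx ?orbT.
have pb : p b = c.
  have : p b \in S by rewrite perm_closed.
  rewrite !inE => /or3P[]/eqP// pb.
    have /subsetP/(_ c) : porbit p a \subset [set a; b].
      by apply: porbit_sub => [|y]; rewrite !inE ?eqxx // => /orP[]/eqP->;
         rewrite ?pa ?pb eqxx ?orbT.
    by rewrite orb // cS !inE ![c == _]eq_sym (negPf ac) (negPf bc) => /(_ isT).
  by move/eqP: (perm_inj (etrans pa (esym pb))); rewrite (negPf ab).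
have pc : p c = a.
  have : p c \in S by rewrite perm_closed.
  rewrite !inE => /or3P[]/eqP// pc.
    by move/eqP: (perm_inj (etrans pa (esym pc))); rewrite (negPf ac).
  by move/eqP: (perm_inj (etrans pb (esym pc))); rewrite (negPf bc).
apply/permP=> x; have [|xS] := boolP (x \in S).
  by rewrite !inE => /or3P[]/eqP->; rewrite ?pa ?pb ?pc.
by rewrite (out_perm pS) // (out_perm qS).
Qed.

Lemma rotation_cycle3 p a b c : uniq [:: a; b; c] ->
  let S := [set x in [:: a; b; c]] in
  perm_on S p -> {in S, forall x, porbit p x = S} ->
  p = cycle3 a b c \/ p = cycle3 a c b.
Proof.
move=> u S pS orb; have aS : a \in S by rewrite !inE eqxx.
have bS : b \in S by rewrite !inE eqxx orbT.
have S' : S = [set x in [:: a; c; b]].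
  by apply/setP=> x; rewrite !inE; congr (_ || _); rewrite orbC.
have : p a \in S by rewrite perm_closed.
rewrite !inE => /or3P[]/eqP pa; last 2 first.
- by left; apply: rotation_cycle3_of.
- right; apply: rotation_cycle3_of => //; rewrite -?S' //.
  by rewrite uniq_swap.
move: u bS; rewrite -(orb a aS) (porbit_fixed pa) inE /= !inE.
move=> /andP[/norP[/negPf ab _] _].
by rewrite eq_sym ab.
Qed.

Lemma cycle3_neq a b c : uniq [:: a; b; c] -> cycle3 a b c <> cycle3 a c b.
Proof.
move=> u /permP/(_ a); have [-> _ _] := cycle3E u; rewrite permM tpermL.
move: u; rewrite /= !inE negb_or => /andP[/andP[_ ac] /andP[bc _]].
by rewrite tpermD // => /eqP; rewrite ?(negPf bc) // eq_sym.
Qed.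

End ThreeCycle.

Section GenusPoly.
Local Open Scope group_scope.
Variable G : sgraph.
Hypothesis cG : cubic G.

Definition spin (b : bool) (v : G) : {perm G} :=
  if enum (nbrs v) is [:: x; y; z] then
    if b then cycle3 x z y else cycle3 x y z
  else 1.

Definition rotation (f : {ffun G -> bool}) : {ffun G -> {perm G}} :=
  [ffun v => spin (f v) v].

(** Pairs (dart into v, reverse dart), in the format expected by [turn]. *)
Definition ports_at (v : G) : seq ((G * G) * (G * G)) :=
  [seq ((u, v), (v, u)) | u <- enum (nbrs v)].

Definition ports := flatten [seq ports_at v | v <- enum G].

Lemma enum_nbrs (v : G) : exists x y z,
  [/\ enum (nbrs v) = [:: x; y; z], uniq [:: x; y; z]
    & nbrs v = [set u in [:: x; y; z]]].
Proof.
have := enum_uniq (nbrs v); have := set_enum (nbrs v); have := cG v; rewrite cardE.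
case: (enum _) => [|x [|y [|z [|]]]] //= _ nE u.
by exists x, y, z; split; rewrite ?nE.
Qed.

Lemma rotationsE : rotations G = [set rotation f | f in setT].
Proof.
apply/setP=> rho; rewrite inE; apply/idP/imsetP => [/forallP rhoP|[f _ ->]].
  exists [ffun v => rho v != spin false v]; rewrite ?inE //.
  apply/ffunP=> v; rewrite !ffunE; have /andP[sv /forall_inP ov] := rhoP v.
  have [x [y [z [e u nE]]]] := enum_nbrs v; rewrite /spin e.
  rewrite nE in sv ov.
  have orb : {in [set u in [:: x; y; z]],
      forall w, porbit (rho v) w = [set u in [:: x; y; z]]}.
    by move=> w /ov/eqP.
  case: (rotation_cycle3 u sv orb) => ->; first by rewrite eqxx.
  by case: eqP => // e'; case: (cycle3_neq u).
apply/forallP=> v; rewrite ffunE /spin; have [x [y [z [-> u ->]]]] := enum_nbrs v.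
have u' : uniq [:: x; z; y] by rewrite uniq_swap.
have eS : [set u in [:: x; y; z]] = [set u in [:: x; z; y]].
  by apply/setP=> w; rewrite !inE; congr (_ || _); rewrite orbC.
case: (f v); last first.
  have [-> orb] := cycle3_rotation u; rewrite /=.
  by apply/forall_inP=> w /orb ->.
have [] := cycle3_rotation u'; rewrite -eS => -> orb /=.
by apply/forall_inP=> w /orb ->.
Qed.

Lemma rotation_inj : injective rotation.
Proof.
move=> f g e; apply/ffunP=> v; move/ffunP/(_ v): e; rewrite !ffunE /spin.
have [x [y [z [-> u _]]]] := enum_nbrs v; have := cycle3_neq u.
by case: (f v); case: (g v) => // n e; case: n.
Qed.

Lemma turns_ports (f : {ffun G -> bool}) (vs : seq G) :
  turns [seq f v | v <- vs] (flatten [seq ports_at v | v <- vs]) =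
  [seq (d, face_perm (rotation f) d)
     | d <- flatten [seq [seq (u, v) | u <- enum (nbrs v)] | v <- vs]].
Proof.
elim: vs => //= v vs IH; rewrite map_cat -{}IH.
have [x [y [z [e u _]]]] := enum_nbrs v; rewrite /ports_at e /= drop0.
have u' : uniq [:: x; z; y] by rewrite uniq_swap.
rewrite /face_perm !permE /face_map /= !ffunE /spin e.
have [c1 c2 c3] := cycle3E u; have [d1 d2 d3] := cycle3E u'.
by case: (f v); rewrite ?c1 ?c2 ?c3 ?d1 ?d2 ?d3.
Qed.

Lemma card_faces (f : {ffun G -> bool}) :
  #|faces (rotation f)| = ncycles (turns [seq f v | v <- enum G] ports).
Proof.
rewrite turns_ports; set s := flatten _.
have memS : s =i darts G.
  move=> [u v]; rewrite inE /=.
  apply/allpairsPdep/idP => [[w [x [_ xw [-> ->]]]]|uv].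
    by move: xw; rewrite mem_enum inE adj_sym.
  by exists v, u; rewrite !mem_enum [u \in _]inE adj_sym.
have us : uniq s.
  by apply: allpairs_uniq_dep => [|w _|[w x] [w' x'] _ _ /= [-> ->]] //;
     apply: enum_uniq.
rewrite ncycles_porbits // => [|d]; last first.
  rewrite !memS; apply: face_perm_dart; rewrite rotationsE; exact: imset_f.
rewrite /faces; apply: eq_card => A.
by apply/imsetP/imsetP => -[d dd ->]; exists d; rewrite ?memS // -memS.
Qed.

(** The dart names are transported along [h] so that the table can be computed
    on concrete data. *)
Lemma genus_polyE (T : eqType) (h : G * G -> T) : injective h ->
  (genus_poly G =
   \sum_(e <- cycle_table #|G| (rename h ports))
     'X^(Num.truncn (1 + #|G|%:R / 4%:R - e.2.1%:R / 2%:R : rat)) *+ e.1)%R.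
Proof.
move=> h_inj; rewrite /genus_poly rotationsE big_imset; last first.
  by move=> ? ? _ _; apply: rotation_inj.
rewrite -(sum_turns (fun k =>
  'X^(Num.truncn (1 + #|G|%:R / 4%:R - k%:R / 2%:R : rat)))%R).
rewrite -sum_bitseqs; apply: eq_big => [f|f _]; first by rewrite inE.
by rewrite /genus card_faces turns_rename ncycles_rename.
Qed.

End GenusPoly.

(** * Graphs given by edge lists *)

Section EdgeGraph.
Variables (n : nat) (E : seq (nat * nat)).

Definition edge_adj (i j : nat) := (i != j) && (((i, j) \in E) || ((j, i) \in E)).

Lemma edge_adj_sym : symmetric edge_adj.
Proof. by move=> i j; rewrite /edge_adj eq_sym orbC. Qed.

Lemma edge_adj_irrefl : irreflexive edge_adj.
Proof. by move=> i; rewrite /edge_adj eqxx. Qed.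

Definition edge_graph : sgraph :=
  @SGraph 'I_n (fun i j => edge_adj i j)
    (fun i j => edge_adj_sym i j) (fun i => edge_adj_irrefl i).

Notation G := edge_graph.

Lemma card_edge_graph : #|G| = n.
Proof. exact: card_ord. Qed.

Definition edge_nbrs (i : nat) := [seq j <- iota 0 n | edge_adj i j].

Lemma val_enum_nbrs (v : G) :
  [seq val u | u <- enum (nbrs v)] = edge_nbrs (val v).
Proof.
rewrite /edge_nbrs -val_enum_ord filter_map; congr map.
by rewrite {1}/enum_mem -enumT; apply: eq_filter => u; rewrite /= inE.
Qed.

Lemma edge_graph_cubic :
  all (fun i => size (edge_nbrs i) == 3) (iota 0 n) -> cubic G.
Proof.
move=> /allP sz v; rewrite cardE -(size_map val) val_enum_nbrs; apply/eqP/sz.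
by rewrite mem_iota /= add0n ltn_ord.
Qed.

(** A dart (u, v) is named by the pair of the numbers of its ends. *)
Definition edge_ports : seq ((nat * nat) * (nat * nat)) :=
  flatten [seq [seq ((j, i), (i, j)) | j <- edge_nbrs i] | i <- iota 0 n].

Lemma rename_ports :
  rename (fun d : G * G => (val d.1, val d.2)) (ports G) = edge_ports.
Proof.
rewrite /rename /ports map_flatten /edge_ports -val_enum_ord -!map_comp.
congr flatten; apply: eq_map => v /=.
by rewrite -val_enum_nbrs /ports_at -!map_comp.
Qed.

Definition face_counts : seq (nat * nat) :=
  [seq (e.1, e.2.1) | e <- cycle_table n edge_ports].

Lemma genus_poly_edge_graph : cubic G ->
  genus_poly G =
   (\sum_(e <- face_counts)
     'X^(Num.truncn (1 + n%:R / 4%:R - e.2%:R / 2%:R : rat)) *+ e.1)%R.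
Proof.
move=> cG; rewrite (genus_polyE cG (h := fun d => (val d.1, val d.2))); last first.
  by move=> [u v] [u' v'] [/val_inj-> /val_inj->].
by rewrite big_map rename_ports card_edge_graph.
Qed.

(** For k faces the genus is (n + 4 - 2 k) / 4; the hypothesis, which holds by
    Euler's formula, makes both the subtraction and the division exact. *)
Lemma coef_genus_poly_edge_graph g : cubic G ->
  all (fun e => (4 %| n + 4 - e.2.*2)%N && (e.2.*2 <= n + 4)%N) face_counts ->
  ((genus_poly G)`_g =
     (sumn [seq e.1 | e <- face_counts & ((n + 4 - e.2.*2) %/ 4 == g)%N])%:R)%R.
Proof.
move=> cG /allP tbP; rewrite genus_poly_edge_graph // coef_sum.
rewrite sumnE big_map big_filter natr_sum [RHS]big_mkcond big_seq [RHS]big_seq.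
apply: eq_bigr => e /tbP /andP[/dvdnP[h hE] le]; rewrite coefMn coefXn.
have -> : (1 + n%:R / 4%:R - e.2%:R / 2%:R : rat)%R = h%:R%R.
  have e4 : (n%:R + 4 = h%:R * 4 + e.2%:R * 2 :> rat)%R.
    by rewrite -!natrM -!natrD -hE muln2 subnK.
  lra.
rewrite natrK hE mulnK // eq_sym; case: eqP => _ //; last exact: mul0rn.
Qed.

Definition sweep (c vis : seq nat) :=
  foldl (fun vis i =>
    if (i \notin c) && (i \notin vis) && has (mem vis) (edge_nbrs i)
    then i :: vis else vis) vis (iota 0 n).

(** A sufficient condition for the graph minus [c] to be connected; three passes
    reach all vertices in the graphs below. *)
Definition spans (c : seq nat) :=
  let V := [seq i <- iota 0 n | i \notin c] in
  let R := sweep c (sweep c (sweep c [:: head 0 V])) in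
  all (mem R) V.

Definition small_cuts : seq (seq nat) :=
  [::] :: [seq [:: i] | i <- iota 0 n]
    ++ [seq [:: i; j] | i <- iota 0 n, j <- iota 0 n].

Section Cut.
Variables (S : {set G}) (c : seq nat).
Hypothesis Sc : forall v : G, (v \in S) = (val v \in c).

Lemma sweep_connect (r : G) vis :
  let ok s := forall i, i \in s ->
    exists2 v : G, val v = i & v \notin S /\ connect (adj_minus S) r v in
  ok vis -> ok (sweep c vis).
Proof.
move=> ok; rewrite /sweep.
have : {subset iota 0 n <= iota 0 n} by [].
elim: {1 3}(iota 0 n) vis => //= i s IH vis sub visP.
apply: IH => [j js|]; first by apply: sub; rewrite inE js orbT.
case: ifP => // /andP[/andP[ic _] /hasP[j ij jv]] k.
rewrite inE => /orP[/eqP->|]; last exact: visP.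
have i_lt : i < n by have := sub i (mem_head _ _); rewrite mem_iota add0n.
have [w wj [wS rw]] := visP j jv.
have iS : (Ordinal i_lt : G) \notin S by rewrite Sc.
exists (Ordinal i_lt : G); rewrite ?iS //; split=> //.
apply: connect_trans rw (connect1 _); rewrite /adj_minus /= wS iS /=.
by move: ij; rewrite mem_filter -wj edge_adj_sym => /andP[].
Qed.

Lemma spans_connect : spans c ->
  forall x y : G, x \notin S -> y \notin S -> connect (adj_minus S) x y.
Proof.
rewrite /spans; set V := filter _ _ => /allP sp x y xS yS.
have inV (v : G) : v \notin S -> val v \in V.
  by move=> vS; rewrite mem_filter -Sc vS mem_iota /= add0n ltn_ord.
have : head 0 V \in V by have := inV x xS; case: (V) => // *; apply: mem_head.
rewrite {1}mem_filter mem_iota add0n /= => /andP[rc r_lt].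
pose r : G := Ordinal r_lt.
have rS : r \notin S by rewrite Sc.
have reach (v : G) : v \notin S -> connect (adj_minus S) r v.
  move=> /inV/sp /=; set R := sweep _ _ => vR.
  pose R2 := sweep c (sweep c [:: head 0 V]).
  have [|w /val_inj <- [] //] := @sweep_connect r R2 _ (val v) vR.
  apply: sweep_connect; apply: sweep_connect => i; rewrite inE => /eqP->.
  by exists r.
have sym : symmetric (adj_minus S).
  by move=> u v; rewrite /adj_minus /= edge_adj_sym andbCA.
apply: connect_trans (reach y yS).
by rewrite (sym_connect_sym sym) reach.
Qed.

End Cut.

Lemma edge_graph_connected : 0 < n -> spans [::] -> connected_graph G.
Proof.
move=> n_gt0 sp; split=> [|x y]; first by rewrite card_edge_graph.
have : connect (adj_minus (set0 : {set G})) x y.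
  apply: (spans_connect (c := [::]) _ sp); rewrite ?in_set0 // => v.
  by rewrite in_set0.
by apply: connect_sub => u v /and3P[_ _ /connect1].
Qed.

Lemma edge_graph_three_connected :
  4 <= n -> all spans small_cuts -> three_connected G.
Proof.
move=> n_ge4 /allP sp; split.
- by apply: edge_graph_connected; [apply: leq_trans n_ge4 | apply: sp].
- by rewrite card_edge_graph.
move=> S [x [y [xS yS]]] /negP nc S2; apply: nc.
have memS (v : G) : (v \in S) = (val v \in map val (enum S)).
  by rewrite (mem_map val_inj) mem_enum.
apply: (spans_connect memS) => //; apply: sp.
move: S2; rewrite cardE; case: (enum S) => [|u [|v [|]]] //= _.
- by rewrite inE mem_cat map_f ?orbT // mem_iota /= add0n ltn_ord.
- rewrite inE mem_cat; apply/orP; right; apply/orP; right.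
  apply/allpairsP; exists (val u, val v).
  by split; rewrite //= mem_iota /= add0n ltn_ord.
Qed.

End EdgeGraph.

(** * Adjacency spectra from integer certificates *)

Section Spectrum.
Local Open Scope ring_scope.

Lemma char_poly_cast (R : nzRingType) m n (e : m = n)
    (B : 'M[R]_m) (A : 'M[R]_n) :
  (forall i j, B i j = A (cast_ord e i) (cast_ord e j)) ->
  char_poly B = char_poly A.
Proof.
case: n / e A => A BA; congr char_poly; apply/matrixP=> i j.
by rewrite BA !cast_ord_id.
Qed.

Lemma char_poly_intertwined (F : fieldType) n (A B Q : 'M[F]_n) :
  Q \in unitmx -> A *m Q = Q *m B -> char_poly A = char_poly B.
Proof.
move=> Qu AQ; have detQ : \det (map_mx polyC Q) != 0.
  by rewrite det_map_mx polyC_eq0 -unitfE -unitmxE.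
apply: (mulIf detQ); rewrite /char_poly [RHS]mulrC -!det_mulmx; congr (\det _).
by rewrite /char_poly_mx mulmxBl mulmxBr -!map_mxM AQ scalar_mxC.
Qed.

Section EdgeMatrix.
Variables (n : nat) (E : seq (nat * nat)).

Definition edge_mx : 'M[algC]_n := \matrix_(i, j) (edge_adj E i j)%:R.

Lemma char_poly_adj_mx : char_poly (adj_mx (edge_graph n E)) = char_poly edge_mx.
Proof.
by apply: (char_poly_cast (e := card_ord n)) => i j; rewrite !mxE !enum_val_ord.
Qed.

(** Up to sign, the constant term of the characteristic polynomial is the
    determinant. *)
Lemma spectrum0 : (0 \in spectrum (edge_graph n E)) = (edge_mx \notin unitmx).
Proof.
rewrite mem_spectrum eigenvalue_root_char char_poly_adj_mx rootE horner_coef0.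
by rewrite char_poly_det mulf_eq0 signr_eq0 unitmxE unitfE negbK.
Qed.

End EdgeMatrix.

Section IntegerCertificate.
Variable n : nat.
Implicit Types f g h : nat -> nat -> int.

Definition int_mx f : 'M[algC]_n := \matrix_(i, j) (f i j)%:~R.

Definition mul_entry f g i j : int :=
  foldr (fun k s => f i k * g k j + s) 0 (iota 0 n).

Definition eq_upto f g :=
  all (fun i => all (fun j => f i j == g i j) (iota 0 n)) (iota 0 n).

Lemma eq_int_mx f g : eq_upto f g -> int_mx f = int_mx g.
Proof.
move=> /allP e; apply/matrixP => i j; rewrite !mxE.
have lt_n (k : 'I_n) : val k \in iota 0 n by rewrite mem_iota /= add0n ltn_ord.
by move/allP: (e _ (lt_n i)) => /(_ _ (lt_n j)) /eqP ->.
Qed.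

Lemma mul_int_mx f g : int_mx f *m int_mx g = int_mx (mul_entry f g).
Proof.
apply/matrixP => i j; rewrite !mxE /mul_entry.
transitivity ((\sum_(k <- iota 0 n) f i k * g k j)%:~R : algC).
  rewrite -[n in iota _ n]subn0 big_mkord rmorph_sum /=.
  by apply: eq_bigr => k _; rewrite !mxE rmorphM.
by congr (_%:~R); elim: (iota 0 n) => [|k s IH]; rewrite ?big_nil // big_cons IH.
Qed.

Lemma edge_mx_int E :
  edge_mx n E = int_mx (fun i j => (edge_adj E i j : nat)%:Z).
Proof. by apply/matrixP => i j; rewrite !mxE. Qed.

Lemma scalar_int_mx (c : int) :
  int_mx (fun i j => if i == j then c else 0) = c%:~R%:M.
Proof.
apply/matrixP => i j; rewrite !mxE -val_eqE.
by case: eqP => _ /=; rewrite ?mulr1n ?mulr0n.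
Qed.

End IntegerCertificate.

End Spectrum.

(** * The four graphs *)

Definition nonsingular_edges : seq (nat * nat) :=
  [:: (0, 1); (0, 2); (0, 4); (1, 2); (1, 5); (2, 3); (3, 4); (3, 6); (4, 8);
      (5, 6); (5, 10); (6, 7); (7, 8); (7, 9); (8, 11); (9, 10); (9, 11); (10, 11)].

Definition singular_edges : seq (nat * nat) :=
  [:: (0, 1); (0, 2); (0, 3); (1, 2); (1, 4); (2, 6); (3, 4); (3, 8); (4, 5);
      (5, 6); (5, 11); (6, 7); (7, 8); (7, 10); (8, 9); (9, 10); (9, 11); (10, 11)].

Definition unswitched_edges : seq (nat * nat) :=
  [:: (0, 1); (0, 2); (0, 4); (1, 5); (1, 7); (2, 5); (2, 6); (3, 8); (3, 9);
      (3, 10); (4, 6); (4, 7); (5, 10); (6, 9); (7, 8); (8, 12); (9, 11); (10, 13);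
      (11, 12); (11, 13); (12, 13)].

Definition switched_edges : seq (nat * nat) :=
  [:: (0, 1); (0, 2); (0, 4); (1, 3); (1, 6); (2, 3); (2, 7); (3, 4); (4, 5);
      (5, 8); (5, 9); (6, 8); (6, 10); (7, 9); (7, 10); (8, 12); (9, 11); (10, 13);
      (11, 12); (11, 13); (12, 13)].

Notation nonsingular_graph := (edge_graph 12 nonsingular_edges).
Notation singular_graph := (edge_graph 12 singular_edges).
Notation unswitched_graph := (edge_graph 14 unswitched_edges).
Notation switched_graph := (edge_graph 14 switched_edges).

Lemma cubic_nonsingular : cubic nonsingular_graph.
Proof. by apply: edge_graph_cubic; vm_compute. Qed.

Lemma cubic_singular : cubic singular_graph.
Proof. by apply: edge_graph_cubic; vm_compute. Qed.

Lemma cubic_unswitched : cubic unswitched_graph.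
Proof. by apply: edge_graph_cubic; vm_compute. Qed.

Lemma cubic_switched : cubic switched_graph.
Proof. by apply: edge_graph_cubic; vm_compute. Qed.

Lemma three_connected_nonsingular : three_connected nonsingular_graph.
Proof. by apply: edge_graph_three_connected; vm_compute. Qed.

Lemma three_connected_singular : three_connected singular_graph.
Proof. by apply: edge_graph_three_connected; vm_compute. Qed.

Lemma connected_unswitched : connected_graph unswitched_graph.
Proof. by apply: edge_graph_connected; vm_compute. Qed.

Lemma connected_switched : connected_graph switched_graph.
Proof. by apply: edge_graph_connected; vm_compute. Qed.

Lemma genus_poly_nonsingular_singular :
  genus_poly nonsingular_graph = genus_poly singular_graph.
Proof.
rewrite (genus_poly_edge_graph cubic_nonsingular).
rewrite (genus_poly_edge_graph cubic_singular).
have -> : face_counts 12 nonsingular_edges = face_counts 12 singular_edges.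
  by vm_compute.
by [].
Qed.

Lemma coef1_genus_poly_unswitched : ((genus_poly unswitched_graph)`_1 = 88%:R)%R.
Proof.
rewrite (coef_genus_poly_edge_graph 1 cubic_unswitched); last by vm_compute.
by set m := sumn _; have -> : m = 88 by vm_compute.
Qed.

Lemma coef1_genus_poly_switched : ((genus_poly switched_graph)`_1 = 64%:R)%R.
Proof.
rewrite (coef_genus_poly_edge_graph 1 cubic_switched); last by vm_compute.
by set m := sumn _; have -> : m = 64 by vm_compute.
Qed.

Lemma genus_poly_switching :
  genus_poly unswitched_graph <> genus_poly switched_graph.
Proof.
move=> e; have := coef1_genus_poly_unswitched.
by rewrite e coef1_genus_poly_switched.
Qed.

Section Certificates.
Local Open Scope ring_scope.

Definition thrice_inverse : seq (seq int) :=
 [:: [:: -2; 2; 2; 0; -1; 0; -1; 0; 2; -1; -1; 1];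
     [:: 2; 0; 0; -2; 0; 1; 0; 1; 0; 0; 0; -1];
     [:: 2; 0; 0; 1; 0; -2; 0; 1; -3; 3; 0; -1];
     [:: 0; -2; 1; 2; 1; -1; 1; -1; -2; 1; 1; 0];
     [:: -1; 0; 0; 1; 0; 1; 0; -2; 3; -3; 0; 2];
     [:: 0; 1; -2; -1; 1; 2; 1; -1; 1; -2; 1; 0];
     [:: -1; 0; 0; 1; 0; 1; 0; 1; 0; 0; 0; -1];
     [:: 0; 1; 1; -1; -2; -1; 1; 2; 1; 1; -2; 0];
     [:: 2; 0; -3; -2; 3; 1; 0; 1; 0; 0; 0; -1];
     [:: -1; 0; 3; 1; -3; -2; 0; 1; 0; 0; 0; 2];
     [:: -1; 0; 0; 1; 0; 1; 0; -2; 0; 0; 0; 2];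
     [:: 1; -1; -1; 0; 2; 0; -1; 0; -1; 2; 2; -2]].

Lemma unit_nonsingular : edge_mx 12 nonsingular_edges \in unitmx.
Proof.
pose M := int_mx 12 (fun i j => nth 0 (nth [::] thrice_inverse i) j).
have e : edge_mx 12 nonsingular_edges *m M = 3%:M.
  rewrite edge_mx_int mul_int_mx -[3%:M](scalar_int_mx 12 3).
  by apply: eq_int_mx; vm_compute.
have /mulmx1_unit[] // : edge_mx 12 nonsingular_edges *m (3^-1 *: M) = 1%:M.
by rewrite -scalemxAr e scale_scalar_mx mulVf ?pnatr_eq0.
Qed.

Lemma not_unit_singular : edge_mx 12 singular_edges \notin unitmx.
Proof.
(* Every row of this matrix is the kernel vector. *)
pose w (i j : nat) : int := if (j %% 3 == 1)%N then -2%:Z else 1.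
have e : int_mx 12 w *m edge_mx 12 singular_edges = 0.
  rewrite edge_mx_int mul_int_mx; transitivity (int_mx 12 (fun _ _ => 0)).
    by apply: eq_int_mx; vm_compute.
  by apply/matrixP => i j; rewrite !mxE.
apply/negP => Bu; have : int_mx 12 w = 0.
  by rewrite -(mulmxK Bu (int_mx 12 w)) e mul0mx.
by move/matrixP/(_ ord0 ord0)/eqP; rewrite !mxE oner_eq0.
Qed.

Lemma spectrum_nonsingular_singular :
  spectrum nonsingular_graph <> spectrum singular_graph.
Proof.
move=> e; have := spectrum0 12 nonsingular_edges.
by rewrite e spectrum0 unit_nonsingular not_unit_singular.
Qed.

Lemma spectrum_switching : spectrum unswitched_graph = spectrum switched_graph.
Proof.
(* [q] is twice the Godsil-McKay involution. *)
pose S := [:: 3; 5; 6; 7]%N.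
pose q (i j : nat) : int :=
  if (i \in S) && (j \in S) then if i == j then -1 else 1
  else if i == j then 2 else 0.
have QQ : int_mx 14 q *m int_mx 14 q = 4%:M.
  by rewrite mul_int_mx -[4%:M](scalar_int_mx 14 4); apply: eq_int_mx; vm_compute.
have Qu : int_mx 14 q \in unitmx.
  have /mulmx1_unit[] // : int_mx 14 q *m (4^-1 *: int_mx 14 q) = 1%:M.
  by rewrite -scalemxAr QQ scale_scalar_mx mulVf ?pnatr_eq0.
rewrite /spectrum !char_poly_adj_mx.
rewrite (char_poly_intertwined Qu (B := edge_mx 14 switched_edges)) //.
by rewrite !edge_mx_int !mul_int_mx; apply: eq_int_mx; vm_compute.
Qed.

End Certificates.

Theorem mainTheorem3 :
  [/\ exists G H : sgraph,
        [/\ three_connected G /\ cubic G, three_connected H /\ cubic H,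
            #|G| = 12 /\ #|H| = 12,
            genus_poly G = genus_poly H & spectrum G <> spectrum H],
      exists G H : sgraph,
        [/\ connected_cubic G, connected_cubic H,
            spectrum G = spectrum H & genus_poly G <> genus_poly H]
    & ~ determines connected_cubic genus_poly spectrum /\
      ~ determines connected_cubic spectrum genus_poly].
Proof.
have [con1 _ _] := three_connected_nonsingular.
have [con2 _ _] := three_connected_singular.
have cc1 : connected_cubic nonsingular_graph := conj con1 cubic_nonsingular.
have cc2 : connected_cubic singular_graph := conj con2 cubic_singular.
have cc3 : connected_cubic unswitched_graph.
  exact: (conj connected_unswitched cubic_unswitched).
have cc4 : connected_cubic switched_graph.
  exact: (conj connected_switched cubic_switched).
split.
- exists nonsingular_graph, singular_graph; split.
  + exact: (conj three_connected_nonsingular cubic_nonsingular).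
  + exact: (conj three_connected_singular cubic_singular).
  + by rewrite !card_edge_graph.
  + exact: genus_poly_nonsingular_singular.
  + exact: spectrum_nonsingular_singular.
- exists unswitched_graph, switched_graph; split.
  + exact: cc3.
  + exact: cc4.
  + exact: spectrum_switching.
  + exact: genus_poly_switching.
split.
- move=> /(_ _ _ cc1 cc2 genus_poly_nonsingular_singular).
  exact: spectrum_nonsingular_singular.
- move=> /(_ _ _ cc3 cc4 spectrum_switching).
  exact: genus_poly_switching.
Qed.
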